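(* Let $q\in(0,1)$ and consider a one-dimensional kinetically constrained model, i.e. the Markov process on $\Omega=\{0,1\}^{\mathbb Z}$ with rates $(c_x)_{x\in\mathbb Z}$ of range $r$ described in the context. Let $\mu$ be a probability measure on $\Omega$ which is stationary for the process (translation invariance is not assumed). Then $\mu$ satisfies detailed balance: for every finite $\Lambda\subset\mathbb Z$, every $x$ with $\{x-r,\dots,x+r\}\subset\Lambda$ and every $\zeta\in\{0,1\}^\Lambda$, $$c_x(\zeta)\,\pi(\zeta^x)\,\mu(\zeta)=c_x(\zeta)\,\pi(\zeta)\,\mu(\zeta^x).$$
   Context: Let $p=1-q$ and let $\pi$ be the product measure on $\Omega=\{0,1\}^{\mathbb Z}$ with $\pi(\eta_x=1)=p$, $\pi(\eta_x=0)=q$. For each $x\in\mathbb Z$, $c_x:\Omega\to[0,\infty)$ is a function (possibly taking the value $0$) that depends only on $(\eta_y)_{0<|y-x|\le r}$ for a fixed integer $r$ (in particular not on $\eta_x$), and $\sup_{x,\eta}c_x(\eta)<\infty$. The process is the Feller process whose generator acts on local functions (functions depending on finitely many coordinates) as $$\mathcal Lf(\eta)=\sum_{x}c_x(\eta)\big((1-\eta_x)(1-q)+\eta_x q\big)\big(f(\eta^x)-f(\eta)\big),$$ where $\eta^x$ is $\eta$ with the value at $x$ flipped. $\mu$ is stationary if it is invariant for the semigroup. For $\zeta\in\{0,1\}^\Lambda$, $\mu(\zeta)$ and $\pi(\zeta)$ denote the probabilities of $\{\eta:\eta_y=\zeta_y\ \forall y\in\Lambda\}$, $\zeta^x$ is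 $\zeta$ flipped at $x$, and $c_x(\zeta)$ is well defined when $\{x-r,\dots,x+r\}\subset\Lambda$. *)

(* Defs.v *)
From HB Require Import structures.
From mathcomp Require Import all_boot all_order all_algebra finmap.
From mathcomp Require Import all_classical all_reals all_analysis.

Set Implicit Arguments.
Unset Strict Implicit.
Unset Printing Implicit Defensive.

Import Order.TTheory GRing.Theory Num.Theory.
Import numFieldNormedType.Exports.

Local Open Scope classical_set_scope.
Local Open Scope ring_scope.

(* Configurations: true is 1 and false is 0. The topology is the product of
   the discrete topologies, and the sigma-algebra is the product one. *)
Definition config : Type := int -> bool.

Definition coordinate_sets : set (set (int -> bool)) :=
  range (fun x : int => [set eta : int -> bool | eta x]).

HB.instance Definition _ := Pointed.copy config (int -> bool).
HB.instance Definition _ := Uniform.copy config {ptws int -> bool}.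
HB.instance Definition _ :=
  Measurable.copy config (g_sigma_algebraType coordinate_sets).

Definition flip (eta : config) (x : int) : config :=
  fun y => if y == x then ~~ eta y else eta y.

Definition cylinder (Lam : {fset int}) (zeta : {ffun Lam -> bool}) :
    set config :=
  [set eta | forall y : Lam, eta (val y) = zeta y].

Definition flip_on (Lam : {fset int}) (zeta : {ffun Lam -> bool}) (x : int) :
    {ffun Lam -> bool} :=
  [ffun y => if val y == x then ~~ zeta y else zeta y].

Definition extend (Lam : {fset int}) (zeta : {ffun Lam -> bool}) : config :=
  fun y => if (insub y : option Lam) is Some z then zeta z else false.

Definition window_sub (r : nat) (x : int) (Lam : {fset int}) : Prop :=
  forall y : int, `|y - x| <= r%:Z -> y \in Lam.

Section KCM.
Context {R : realType}.
Implicit Types (q : R) (c : int -> config -> R) (f g : config -> R).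

Definition local_function f : Prop :=
  exists Lam : {fset int}, forall eta eta' : config,
    (forall y, y \in Lam -> eta y = eta' y) -> f eta = f eta'.

Record kcm_rates (r : nat) c : Prop := KcmRates {
  rate_ge0 : forall x eta, 0 <= c x eta;
  rate_range : forall x (eta eta' : config),
    (forall y, 0 < `|y - x| <= r%:Z -> eta y = eta' y) -> c x eta = c x eta';
  rate_bounded : exists M : R, forall x eta, c x eta <= M
}.

(* c_x(zeta); when window_sub r x Lam holds it does not depend on the chosen
   extension of zeta, see rate_onE. *)
Definition rate_on c (x : int) (Lam : {fset int}) (zeta : {ffun Lam -> bool}) :
    R :=
  c x (extend zeta).

Lemma rate_onE (r : nat) c (x : int) (Lam : {fset int})
    (zeta : {ffun Lam -> bool}) (eta : config) :
  kcm_rates r c -> window_sub r x Lam -> cylinder zeta eta ->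
  c x eta = rate_on c x zeta.
Proof.
move=> hc hw hz; apply: (rate_range hc) => y /andP[_ /hw yLam].
by rewrite /extend insubT /= -hz.
Qed.

(* The sum over all sites has finite support when f is local; \sum_(_ \in _)
   is the sum over that support. *)
Definition kcm_generator q c f : config -> R := fun eta =>
  \sum_(x \in [set: int])
    c x eta * ((1 - (eta x)%:R) * (1 - q) + (eta x)%:R * q)
      * (f (flip eta x) - f eta).

(* Feller semigroup on C(config); only the values of S t f for 0 <= t and f
   continuous are meaningful. *)
Record feller_semigroup (S : R -> (config -> R) -> (config -> R)) : Prop :=
  FellerSemigroup {
  feller_continuous : forall (t : R) f, 0 <= t -> continuous f -> continuous (S t f);
  feller_linear : forall (t a : R) f g, 0 <= t -> continuous f ->
    continuous g -> S t (a *: f + g) = a *: S t f + S t g;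
  feller_one : forall t : R, 0 <= t -> S t (cst 1) = cst 1;
  feller_pos : forall (t : R) f, 0 <= t -> continuous f ->
    (forall eta, 0 <= f eta) -> forall eta, 0 <= S t f eta;
  feller_0 : forall f, continuous f -> S 0 f = f;
  feller_add : forall (s t : R) f, 0 <= s -> 0 <= t -> continuous f ->
    S (s + t) f = S s (S t f);
  feller_cvg0 : forall f, continuous f ->
    {uniform, S t f @[t --> 0^'+] --> f}
}.

(* f is in the domain of the generator of S and is mapped to g by it. *)
Definition generator_at (S : R -> (config -> R) -> (config -> R)) f g : Prop :=
  {uniform, (fun eta : config => t^-1 * (S t f eta - f eta)) @[t --> 0^'+]
    --> g}.

(* S is the semigroup of the process: local functions form a core, so this
   determines S t f for all 0 <= t and f continuous. *)
Definition kcm_semigroup q c (S : R -> (config -> R) -> (config -> R)) : Prop :=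
  feller_semigroup S /\
  forall f, local_function f -> generator_at S f (kcm_generator q c f).

Definition stationary (S : R -> (config -> R) -> (config -> R))
    (mu : probability config R) : Prop :=
  forall (t : R) f, 0 <= t -> continuous f ->
    (\int[mu]_eta (S t f eta)%:E = \int[mu]_eta (f eta)%:E)%E.

Definition product_measure q (pi : probability config R) : Prop :=
  forall (Lam : {fset int}) (zeta : {ffun Lam -> bool}),
    pi (cylinder zeta) = (\prod_(y : Lam) (if zeta y then 1 - q else q))%:E.

End KCM.

(* Main.v *)
Require Import Defs.
From mathcomp Require Import all_boot all_order all_algebra finmap.
From mathcomp Require Import all_classical all_reals all_analysis.
From mathcomp Require Import measurable_realfun zify ring lra.

(* The argument is the entropy method of Holley and Stroock.  On boxes L_k
   whose margins grow by r+1, test stationarity against ln (h + eps), where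
   h = mu / pi is the density of the marginal on L_(k+1).  A site x of L_k
   contributes at most - dirichlet / 4, where the Dirichlet form sums
   psi (u, v) = (u - v)^2 / (u + v) over the probability fluxes u, v of the two
   opposite flips at x.  A site of the margin L_(k+1) \ L_k contributes
   positively only through pairs whose net flux goes against the density
   gradient; there the source of the larger flux has the smaller density, so
   ln s <= s and (ln s)^2 <= 4 s bound the contribution by a constant, and also
   by lam * dirichlet + C / lam for every lam > 0, the Dirichlet form being that
   of the next box.  As psi is subadditive, Dirichlet forms increase with the
   box, and the total e_k of the interior Dirichlet forms is nondecreasing,
   bounded, and satisfies e_k <= lam (e_(k+1) - e_k) + D / lam.  In dimension
   one D does not depend on k, which forces e_k = 0: all opposite fluxes
   agree.  Rates may vanish: on the margin the fluxes only need to be bounded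
   above by the mass. *)

Set Implicit Arguments.
Unset Strict Implicit.
Unset Printing Implicit Defensive.

Import Order.TTheory GRing.Theory Num.Theory.
Import numFieldNormedType.Exports.
Local Open Scope classical_set_scope.
Local Open Scope ring_scope.

(** * Cylinders and their masses *)

Definition restr (Lam : {fset int}) (eta : config) : {ffun Lam -> bool} :=
  [ffun y => eta (val y)].

Lemma cylinderE (Lam : {fset int}) (zeta : {ffun Lam -> bool}) :
  cylinder zeta = [set eta | restr Lam eta = zeta].
Proof.
apply/seteqP; split=> eta /=.
  by move=> h; apply/ffunP => y; rewrite ffunE h.
by move=> <- y; rewrite ffunE.
Qed.

Lemma extend_in (Lam : {fset int}) (zeta : {ffun Lam -> bool}) (y : Lam) :
  extend zeta (val y) = zeta y.
Proof. by rewrite /extend valK. Qed.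

Lemma restr_extend (Lam : {fset int}) (zeta : {ffun Lam -> bool}) :
  restr Lam (extend zeta) = zeta.
Proof. by apply/ffunP => y; rewrite ffunE extend_in. Qed.

Lemma extend_restr (Lam : {fset int}) (eta : config) y :
  y \in Lam -> extend (restr Lam eta) y = eta y.
Proof. by move=> yL; rewrite -[y]/(val [` yL]%fset) extend_in ffunE. Qed.

Lemma eq_restr (Lam : {fset int}) (eta eta' : config) :
  (forall y, y \in Lam -> eta y = eta' y) -> restr Lam eta = restr Lam eta'.
Proof. by move=> h; apply/ffunP => y; rewrite !ffunE h// (valP y). Qed.

Lemma restr_flip (Lam : {fset int}) (eta : config) x :
  restr Lam (flip eta x) = flip_on (restr Lam eta) x.
Proof. by apply/ffunP => y; rewrite !ffunE. Qed.

Lemma flip_onK (Lam : {fset int}) (zeta : {ffun Lam -> bool}) x :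
  flip_on (flip_on zeta x) x = zeta.
Proof.
by apply/ffunP => y; rewrite !ffunE; case: eqP => // _; rewrite negbK.
Qed.

Lemma flip_on_inj (Lam : {fset int}) x :
  injective (fun zeta : {ffun Lam -> bool} => flip_on zeta x).
Proof. by apply: inv_inj => zeta; exact: flip_onK. Qed.

Lemma restr_extend_sub (Lam Lam' : {fset int}) (eta : config) :
  (Lam `<=` Lam')%fset -> restr Lam (extend (restr Lam' eta)) = restr Lam eta.
Proof. by move=> /fsubsetP s; apply: eq_restr => y /s; exact: extend_restr. Qed.

Lemma restr_flip_on (Lam Lam' : {fset int}) (zeta : {ffun Lam' -> bool}) x :
  (Lam `<=` Lam')%fset ->
  restr Lam (extend (flip_on zeta x)) = flip_on (restr Lam (extend zeta)) x.
Proof.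
move=> s; rewrite -restr_flip.
by rewrite -{1}(restr_extend zeta) -restr_flip restr_extend_sub.
Qed.

Lemma extend_flip_on_neq (Lam : {fset int}) (zeta : {ffun Lam -> bool}) x y :
  y != x -> extend (flip_on zeta x) y = extend zeta y.
Proof.
move=> yx; rewrite /extend; case: insubP => // u _ uy.
by rewrite ffunE uy (negbTE yx).
Qed.

Lemma extend_flip_on_eq (Lam : {fset int}) (zeta : {ffun Lam -> bool}) x :
  x \in Lam -> extend (flip_on zeta x) x = ~~ extend zeta x.
Proof.
by move=> xL; rewrite -[x]/(val [` xL]%fset) !extend_in ffunE eqxx.
Qed.

Lemma measurable_cylinder (Lam : {fset int}) (zeta : {ffun Lam -> bool}) :
  measurable (cylinder zeta).
Proof.
have -> : cylinder zeta =
    \big[setI/setT]_(y : Lam) [set eta : config | eta (val y) = zeta y].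
  apply/seteqP; split=> eta /=.
    by move=> h; rewrite -bigcap_seq => y _ /=; rewrite h.
  by rewrite -bigcap_seq => h y; apply: h; rewrite /= mem_index_enum.
apply: bigsetI_measurable => y _.
have mx : measurable [set eta : config | eta (val y)].
  by apply: (@sub_gen_smallest _ _ coordinate_sets); exists (val y).
case: (zeta y) => //.
rewrite (_ : [set _ | _] = ~` [set eta : config | eta (val y)]).
  exact: measurableC.
by apply/seteqP; split=> eta /=; case: (eta (val y)).
Qed.

Section Mass.
Context {R : realType} (mu : probability config R).

Definition mass (Lam : {fset int}) (zeta : {ffun Lam -> bool}) : R :=
  fine (mu (cylinder zeta)).

Lemma massE (Lam : {fset int}) (zeta : {ffun Lam -> bool}) :
  mu (cylinder zeta) = (mass zeta)%:E.
Proof.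
by rewrite /mass fineK//; apply: fin_num_measure; exact: measurable_cylinder.
Qed.

Lemma mass_ge0 (Lam : {fset int}) (zeta : {ffun Lam -> bool}) : 0 <= mass zeta.
Proof. by rewrite /mass fine_ge0. Qed.

(** Nonnegativity makes the integral additive without integrability conditions; [mass_restr]
    recovers signed functions. *)
Lemma integral_restr (Lam : {fset int}) (F : {ffun Lam -> bool} -> R) :
  (forall zeta, 0 <= F zeta) ->
  (\int[mu]_eta (F (restr Lam eta))%:E = (\sum_zeta F zeta * mass zeta)%:E)%E.
Proof.
move=> F0.
under eq_integral => eta _.
  rewrite (_ : (F _)%:E =
      \sum_zeta (F zeta * \1_(cylinder zeta) eta)%:E)%E; last first.
    rewrite sumEFin; congr _%:E; rewrite (bigD1 (restr Lam eta))//= big1.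
      by rewrite addr0 indicE mem_set ?mulr1// cylinderE.
    move=> zeta ne; rewrite indicE memNset ?mulr0// cylinderE /= => h.
    by rewrite h eqxx in ne.
  over.
rewrite ge0_integral_sum//=.
- rewrite -sumEFin; apply: eq_bigr => zeta _.
  under eq_integral do rewrite EFinM.
  rewrite ge0_integralZl_EFin//.
  + rewrite integral_indic//; last exact: measurable_cylinder.
    by rewrite setIT EFinM; congr (_ * _)%E; exact: massE.
  + apply/measurable_EFinP/measurable_indic; exact: measurable_cylinder.
- move=> zeta; apply/measurable_EFinP; apply: measurable_funM => //.
  by apply: measurable_indic; exact: measurable_cylinder.
- by move=> zeta eta _; rewrite lee_fin mulr_ge0.
Qed.

Lemma mass_sum1 (Lam : {fset int}) :
  \sum_(zeta : {ffun Lam -> bool}) mass zeta = 1.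
Proof.
have := @integral_restr Lam (fun=> 1) (fun=> ler01).
rewrite integral_cst// mul1e [X in X = _](@probability_setT _ _ _ mu) => -[->].
by apply: eq_bigr => *; rewrite mul1r.
Qed.

(** Consistency of the marginals: for a nonnegative [G] both sides integrate the same function of
    [eta], and a signed [G] is split into positive and negative parts. *)
Lemma mass_restr (Lam Lam' : {fset int}) (G : {ffun Lam -> bool} -> R) :
  (Lam `<=` Lam')%fset ->
  \sum_(zeta' : {ffun Lam' -> bool}) G (restr Lam (extend zeta')) * mass zeta' =
  \sum_zeta G zeta * mass zeta.
Proof.
move=> s.
have H (Q : {ffun Lam -> bool} -> R) : (forall zeta, 0 <= Q zeta) ->
    \sum_(zeta' : {ffun Lam' -> bool})
      Q (restr Lam (extend zeta')) * mass zeta' = \sum_zeta Q zeta * mass zeta.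
  move=> Q0; apply: EFin_inj; rewrite -integral_restr//.
  rewrite -(@integral_restr Lam' (fun z => Q (restr Lam (extend z))))//.
  by apply: eq_integral => eta _; rewrite restr_extend_sub.
have := H _ (fun zeta => funrpos_ge0 G zeta).
have := H _ (fun zeta => funrneg_ge0 G zeta).
move=> Hn Hp; transitivity (\sum_zeta G^\+ zeta * mass zeta
                            - \sum_zeta G^\- zeta * mass zeta).
  rewrite -Hn -Hp -sumrB; apply: eq_bigr => z _.
  by rewrite -mulrBl -[in LHS](funrposBneg G).
rewrite -sumrB; apply: eq_bigr => z _.
by rewrite -mulrBl -[in RHS](funrposBneg G).
Qed.

End Mass.

(** * Stationarity tested on local functions *)

Lemma coordinate_near (eta : config) (y : int) :
  \forall eta' \near eta, (eta' : config) y = eta y.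
Proof.
have /(_ [set b | b = eta y]) := @proj_continuous int (fun=> bool) y eta.
by apply; exact: (@discrete_set1 bool (eta y)).
Qed.

Section Stationarity.
Context {R : realType}.
Implicit Types (q : R) (c : int -> config -> R).

Lemma local_continuous (f : config -> R) : local_function f -> continuous f.
Proof.
move=> [Lam fL] eta.
have h : \forall eta' \near eta,
    forall y : Lam, (eta' : config) (val y) = eta (val y).
  refine (@filter_forall _ _ (fun (y : Lam) =>
    [set eta' : config | eta' (val y) = eta (val y)]) _ (nbhs_filter eta) _).
  by move=> y; exact: coordinate_near.
apply: (@near_cst_continuous _ _ (f eta)).
apply: filterS h => eta' h; apply: fL => y yL.
exact: (h [` yL]%fset).
Qed.

Lemma local_restr (Lam : {fset int}) (F : {ffun Lam -> bool} -> R) :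
  local_function (fun eta => F (restr Lam eta)).
Proof. by exists Lam => eta eta' h; rewrite (eq_restr h). Qed.

(** The one-site marginal of the product measure; a flip at [x] has rate [c x] times the weight of
    the new value. *)
Definition weight q (b : bool) : R := if b then 1 - q else q.

Lemma kcm_generator_local q c (f : config -> R) (Lam : {fset int}) :
  (forall eta eta' : config,
    (forall y, y \in Lam -> eta y = eta' y) -> f eta = f eta') ->
  forall eta, kcm_generator q c f eta =
    \sum_(x <- Lam) c x eta * weight q (~~ eta x) * (f (flip eta x) - f eta).
Proof.
move=> fL eta; rewrite /kcm_generator.
rewrite (@fsbigTE _ _ _ _ Lam) /=.
  apply: eq_bigr => x _; congr (_ * _ * _); rewrite /weight.
  by case: (eta x) => /=; ring.
move=> x xL; rewrite (fL (flip eta x) eta) ?subrr ?mulr0// => y yL.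
by rewrite /flip; case: eqP => // yx; rewrite yx (negbTE xL) in yL.
Qed.

Lemma generator_at_small (S : R -> (config -> R) -> config -> R)
    (f g : config -> R) (e d : R) : 0 < e -> 0 < d -> generator_at S f g ->
  exists t : R, [/\ 0 < t, t < d &
    forall eta, `|t^-1 * (S t f eta - f eta) - g eta| < e].
Proof.
move=> e0 d0 hg.
have hP : nbhs (g : {uniform config -> R})
    [set h | forall y, `|g y - h y| < e].
  apply/uniform_nbhs; exists [set xy | `|xy.1 - xy.2| < e]; split.
    exact: (@entourage_ball _ R (PosNum e0)).
  by move=> h /= hh y; exact: hh.
have n1 : \forall t \near (0:R)^'+,
    forall y, `|g y - t^-1 * (S t f y - f y)| < e by exact: hg _ hP.
have n2 : \forall t \near (0:R)^'+, t < d by exact: nbhs_right_lt.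
have n3 : \forall t \near (0:R)^'+, 0 < t by exact: nbhs_right_gt.
have [t [h1 [h2 h3]]] := filter_ex (filterI n3 (filterI n2 n1)).
by exists t; split => // eta; rewrite distrC.
Qed.

Context (S : R -> (config -> R) -> config -> R) (mu : probability config R).
Context (mu_stat : stationary S mu).

(* Bounding S t F from below by a cylinder function is enough to compare
   integrals, without measurability of S t F. *)
Let feller_lower (Lam : {fset int}) (F H : {ffun Lam -> bool} -> R) t :
  0 <= t -> (forall zeta, 0 <= H zeta) -> (forall zeta, 0 <= F zeta) ->
  (forall eta, H (restr Lam eta) <= S t (fun eta' => F (restr Lam eta')) eta) ->
  \sum_zeta H zeta * mass mu zeta <= \sum_zeta F zeta * mass mu zeta.
Proof.
move=> t0 H0 F0 HS; rewrite -lee_fin -!integral_restr//.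
have cF := local_continuous (local_restr F).
rewrite -(mu_stat t0 cF) !ge0_integralTE//=.
(* The integral of a nonnegative function is a supremum over the simple functions below it, hence
   monotone. *)
- by apply: le_ereal_sup => _ [h /= hH <-]; exists h => // eta;
    rewrite (le_trans (hH eta))// lee_fin.
- by move=> eta; rewrite lee_fin (le_trans (H0 _) (HS _)).
- by move=> eta; rewrite lee_fin.
Qed.

(** Stationarity is applied to [S t F >= F + t * (G - e)], valid at some small time [t]. As
    [1 <= F], the right-hand side is nonnegative once [t * (B + e) < 1], with [B] a bound on [G]. *)
Let generator_mean_le0 (Lam : {fset int}) (F G : {ffun Lam -> bool} -> R) :
  (forall zeta, 1 <= F zeta) ->
  generator_at S
    (fun eta => F (restr Lam eta)) (fun eta => G (restr Lam eta)) ->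
  \sum_zeta G zeta * mass mu zeta <= 0.
Proof.
move=> F1 gF; apply/ler_addgt0Pr => e e0; rewrite add0r.
pose B := \sum_zeta `|G zeta|.
have GB zeta : `|G zeta| <= B.
  by rewrite /B (bigD1 zeta)//= lerDl sumr_ge0.
have B0 : 0 <= B by rewrite sumr_ge0.
have d0 : 0 < (B + e)^-1 by rewrite invr_gt0; lra.
have [t [t0 td tS]] := generator_at_small e0 d0 gF.
have tB : t * (B + e) < 1.
  by rewrite -(@mulVf _ (B + e)) ?ltr_pM2r//; lra.
have := @feller_lower Lam F (fun zeta => F zeta + t * (G zeta - e)) t (ltW t0).
have -> : \sum_zeta (F zeta + t * (G zeta - e)) * mass mu zeta =
    \sum_zeta F zeta * mass mu zeta +
    t * (\sum_zeta G zeta * mass mu zeta - e).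
  rewrite -[e in RHS]mulr1 -(mass_sum1 mu Lam) mulr_sumr -sumrB mulr_sumr.
  by rewrite -big_split/=; apply: eq_bigr => z _; ring.
move=> h; rewrite -subr_le0 -(pmulr_rle0 _ t0).
suff : \sum_zeta F zeta * mass mu zeta +
    t * (\sum_zeta G zeta * mass mu zeta - e) <=
    \sum_zeta F zeta * mass mu zeta.
  by rewrite gerDl.
apply: h => [zeta|zeta|eta].
- have := F1 zeta; have := GB zeta; rewrite ler_norml => /andP[g1 _] f1.
  have : t * (- (B + e)) <= t * (G zeta - e) by rewrite ler_pM2l//; lra.
  lra.
- by rewrite (le_trans ler01).
- have := tS eta; rewrite ltr_norml => /andP[+ _].
  rewrite ltrBrDl => h; rewrite -lerBrDl -ler_pdivlMl//; lra.
Qed.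

Context (q : R) (c : int -> config -> R) (r : nat).
Context (c_rates : kcm_rates r c).
Context (S_gen :
  forall f, local_function f -> generator_at S f (kcm_generator q c f)).

(** The rate under [mu] of jumps out of [zeta] by a flip at [x], provided that [Lam] contains the
    window of [x]; otherwise [extend] reads 0 outside [Lam]. *)
Definition flip_flux (Lam : {fset int}) (x : int)
    (zeta : {ffun Lam -> bool}) : R :=
  c x (extend zeta) * weight q (~~ extend zeta x) * mass mu zeta.

(** The generator has mean zero on local functions. Since [Lam'] contains the windows, it maps
    functions on [Lam] to functions on [Lam']. *)
Lemma stationary_flux (Lam Lam' : {fset int}) (F : {ffun Lam -> bool} -> R) :
  (Lam `<=` Lam')%fset -> (forall x, x \in Lam -> window_sub r x Lam') ->
  \sum_(x <- Lam) \sum_(zeta' : {ffun Lam' -> bool})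
     flip_flux x zeta' * (F (flip_on (restr Lam (extend zeta')) x) -
                     F (restr Lam (extend zeta'))) = 0.
Proof.
move=> s hw.
pose LF (K : {ffun Lam -> bool} -> R) (zeta' : {ffun Lam' -> bool}) :=
  \sum_(x <- Lam) c x (extend zeta') * weight q (~~ extend zeta' x) *
    (K (flip_on (restr Lam (extend zeta')) x) - K (restr Lam (extend zeta'))).
have gen K : generator_at S
    (fun eta => K (restr Lam (extend (restr Lam' eta))))
    (fun eta => LF K (restr Lam' eta)).
  have -> : (fun eta => K (restr Lam (extend (restr Lam' eta)))) =
      (fun eta => K (restr Lam eta)).
    by apply/funext => eta; rewrite restr_extend_sub.
  have -> : (fun eta => LF K (restr Lam' eta)) =
      kcm_generator q c (fun eta => K (restr Lam eta)).
    apply/funext => eta; rewrite (@kcm_generator_local _ _ _ Lam); last first.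
      by move=> e e' h; rewrite (eq_restr h).
    apply: eq_big_seq => x xL; rewrite restr_flip restr_extend_sub//.
    rewrite extend_restr ?(fsubsetP s)//; congr (_ * _ * _).
    apply: (rate_range c_rates) => y /andP[_ yx].
    by rewrite extend_restr//; exact: (hw x).
  exact/S_gen/local_restr.
(* Both [M + F] and [M - F] are at least 1 and the generator kills constants, so
   [generator_mean_le0] yields the two inequalities. *)
pose M := 1 + \sum_zeta `|F zeta|.
have FM zeta : `|F zeta| <= M - 1.
  by rewrite /M addrC addKr (bigD1 zeta)//= lerDl sumr_ge0.
have E : \sum_(zeta' : {ffun Lam' -> bool}) LF F zeta' * mass mu zeta' = 0.
  apply/eqP; rewrite eq_le; apply/andP; split.
    rewrite (_ : LF F = LF (fun z => M + F z)).
      apply: (@generator_mean_le0 Lam'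
        (fun z => M + F (restr Lam (extend z)))) => [z|];
        last exact: (gen (fun z => M + F z)).
      by have := FM (restr Lam (extend z)); rewrite ler_norml => /andP[*]; lra.
    by apply/funext => z; apply: eq_bigr => x _; congr (_ * _); ring.
  rewrite -oppr_le0 -sumrN.
  rewrite (eq_bigr (fun z => LF (fun z => M - F z) z * mass mu z)).
    apply: (@generator_mean_le0 Lam'
        (fun z => M - F (restr Lam (extend z)))) => [z|];
        last exact: (gen (fun z => M - F z)).
    by have := FM (restr Lam (extend z)); rewrite ler_norml => /andP[*]; lra.
  move=> z _; rewrite -mulNr -sumrN; congr (_ * _).
  by apply: eq_bigr => x _; rewrite -mulrN; congr (_ * _); ring.
rewrite exchange_big/= -[RHS]E; apply: eq_bigr => z _; rewrite mulr_suml.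
by apply: eq_bigr => x _; rewrite /flip_flux; ring.
Qed.

End Stationarity.

(** * Elementary inequalities *)

Section RealInequalities.
Context {R : realType}.
Implicit Types (a b u v eps lam C : R).

(* psi 0 0 = 0, as 0 / 0 = 0. *)
Definition psi u v : R := (u - v) ^+ 2 / (u + v).

Lemma psiC u v : psi u v = psi v u.
Proof. by rewrite /psi -sqrrN opprB [u + v]addrC. Qed.

Lemma psi_ge0 u v : 0 <= u -> 0 <= v -> 0 <= psi u v.
Proof. by move=> u0 v0; rewrite /psi divr_ge0 ?sqr_ge0 ?addr_ge0. Qed.

Lemma psi_eq0 u v : 0 <= u -> 0 <= v -> psi u v = 0 -> u = v.
Proof.
move=> u0 v0 /eqP; rewrite /psi mulf_eq0 sqrf_eq0 invr_eq0 subr_eq0.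
by rewrite paddr_eq0// => /orP[/eqP//|/andP[/eqP-> /eqP->]].
Qed.

(** [psi] is convex and homogeneous of degree one; away from zero denominators the defect is a
    square over a positive quantity. *)
Lemma psi_add u v u' v' : 0 <= u -> 0 <= v -> 0 <= u' -> 0 <= v' ->
  psi (u + u') (v + v') <= psi u v + psi u' v'.
Proof.
move=> u0 v0 u'0 v'0.
have [s0|s0] := eqVneq (u + v) 0.
  have [-> ->] : u = 0 /\ v = 0 by split; lra.
  by rewrite !add0r lerDr psi_ge0.
have [s'0|s'0] := eqVneq (u' + v') 0.
  have [-> ->] : u' = 0 /\ v' = 0 by split; lra.
  by rewrite !addr0 lerDl psi_ge0.
have {}s0 : 0 < u + v by rewrite lt_neqAle eq_sym s0 addr_ge0.
have {}s'0 : 0 < u' + v' by rewrite lt_neqAle eq_sym s'0 addr_ge0.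
rewrite /psi -subr_ge0.
have -> : (u - v) ^+ 2 / (u + v) + (u' - v') ^+ 2 / (u' + v') -
    (u + u' - (v + v')) ^+ 2 / (u + u' + (v + v')) =
    ((u - v) * (u' + v') - (u' - v') * (u + v)) ^+ 2 /
    ((u + v) * (u' + v') * (u + u' + (v + v'))).
  by field; rewrite !gt_eqF//; lra.
by rewrite divr_ge0 ?sqr_ge0// !mulr_ge0//; lra.
Qed.

Lemma psi_sum (I : Type) (s : seq I) (P : pred I) (u v : I -> R) :
  (forall i, 0 <= u i) -> (forall i, 0 <= v i) ->
  psi (\sum_(i <- s | P i) u i) (\sum_(i <- s | P i) v i) <=
  \sum_(i <- s | P i) psi (u i) (v i).
Proof.
move=> u0 v0; elim: s => [|i s IH]; first by
  rewrite !big_nil /psi subrr expr0n mul0r.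
rewrite !big_cons; case: (P i) => //; apply: le_trans (psi_add _ _ _ _) _ => //;
  by rewrite ?sumr_ge0// lerD2l.
Qed.

(** For [a < b], [ln (1 + t) <= t] bounds the difference of logarithms below by
    [(b - a) / (b + eps)], and [eps <= b] gives [b + eps <= 2 * (a + b)], whence the factor 2. The
    other order follows by symmetry. *)
Lemma psi_le_ln k a b eps : 0 < eps -> 0 <= k -> 0 <= a -> 0 <= b ->
  (0 < a -> eps <= a) -> (0 < b -> eps <= b) ->
  psi (k * a) (k * b) <=
    2 * ((k * b - k * a) * (ln (b + eps) - ln (a + eps))).
Proof.
move=> e0 k0.
have H x y : 0 <= x -> x < y -> (0 < y -> eps <= y) ->
    psi (k * x) (k * y) <=
      2 * ((k * y - k * x) * (ln (y + eps) - ln (x + eps))).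
  move=> x0 xy /(_ (le_lt_trans x0 xy)) ey.
  have [->|kn0] := eqVneq k 0.
    by rewrite !mul0r /psi subrr expr0n !mul0r mulr0.
  have {}k0 : 0 < k by rewrite lt_neqAle eq_sym kn0.
  have -> : psi (k * x) (k * y) = k * (y - x) * ((y - x) / (x + y)).
    by rewrite /psi; field; rewrite !gt_eqF//; nra.
  have L : (y - x) / (y + eps) <= ln (y + eps) - ln (x + eps).
    rewrite -[X in _ <= X]opprB lerNr -ln_div ?posrE; [|lra|lra].
    have -> : (x + eps) / (y + eps) = 1 + - ((y - x) / (y + eps)).
      by field; rewrite gt_eqF//; lra.
    apply: le_ln1Dx; rewrite ltrN2 ltr_pdivrMr; lra.
  have M : (y - x) / (x + y) <= 2 * ((y - x) / (y + eps)).
    rewrite mulrCA; apply: ler_wpM2l; first by lra.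
    rewrite ler_pdivlMr; last by lra.
    by rewrite mulrC ler_pdivrMr; lra.
  rewrite -[k * y - k * x]mulrBr [2 * _]mulrCA; apply: ler_wpM2l; last by lra.
  by apply: mulr_ge0; lra.
move=> a0 b0 ea eb; have [ab|ba|->] := ltgtP a b.
- exact: H.
- rewrite psiC -[(k * b - k * a) * _]mulrNN !opprB; exact: H.
- by rewrite /psi !subrr expr0n mul0r !mulr0.
Qed.

(** With [t = ln s / 2], [s = expR t ^+ 2 >= (1 + t) ^+ 2 >= t ^+ 2]. *)
Lemma ln_sqr_le (s : R) : 1 <= s -> ln s ^+ 2 <= 4 * s.
Proof.
move=> s1; have s0 : 0 < s by lra.
have l0 := ln_ge0 s1.
rewrite -[s in X in _ <= X](lnK (x := s)) ?posrE//.
have -> : ln s = ln s / 2 + ln s / 2 by field.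
rewrite expRD.
have h := expR_ge1Dx (ln s / 2); have : 0 <= ln s / 2 by lra.
by move: h; set t := ln s / 2; set E := expR t => h t0; nra.
Qed.

(** Here [v] leaves the configuration of density [b] and mass [m], and [u] is the opposite flux.
    Adding [eps] to both densities only lowers their ratio, so [s <= a / b]. The product
    [m * (a / b)] is kept because its sum over configurations stays bounded. *)
Lemma bad_pair_le u v a b eps C m : 0 < eps -> 0 <= u -> u < v -> 0 < b ->
  b < a -> v <= C * m ->
  let X := (v - u) * (ln (a + eps) - ln (b + eps)) in
  X <= C * (m * (a / b)) /\
  forall lam, 0 < lam -> X <= lam * psi u v + 2 * C / lam * (m * (a / b)).
Proof.
move=> e0 u0 uv b0 ba vC X.
have ab1 : 1 <= a / b by rewrite ler_pdivlMr; lra.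
pose s := (a + eps) / (b + eps).
have s1 : 1 <= s by rewrite ler_pdivlMr; lra.
have sab : s <= a / b.
  rewrite ler_pdivrMr; last by lra.
  by rewrite mulrDr divfK ?gt_eqF// lerD2l ler_peMl// ltW.
have -> : X = (v - u) * ln s by rewrite /X /s ln_div ?posrE; lra.
have l0 := ln_ge0 s1.
have ls : ln s < s by apply: ln_sublinear; lra.
have l4 := ln_sqr_le s1.
have vab : v * (a / b) <= C * m * (a / b) by rewrite ler_wpM2r//; lra.
split=> [|lam lam0].
  by rewrite mulrA; apply: le_trans vab; apply: ler_pM; lra.
have -> : 2 * C / lam * (m * (a / b)) = 2 / lam * (C * m * (a / b)) by ring.
apply: (@le_trans _ _ (lam * psi u v + 2 / lam * (v * (a / b)))); last first.
  by rewrite lerD2l ler_wpM2l// divr_ge0; lra.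
(* AM-GM between (v - u) / sqrt (u + v) and sqrt (u + v) * ln s. *)
apply: (@le_trans _ _ (lam * psi u v + (u + v) * ln s ^+ 2 / (4 * lam))).
  rewrite -subr_ge0 /psi.
  have -> : lam * ((u - v) ^+ 2 / (u + v)) + (u + v) * ln s ^+ 2 / (4 * lam) -
     (v - u) * ln s = (2 * lam * (v - u) - (u + v) * ln s) ^+ 2 /
       (4 * lam * (u + v)) by field; rewrite !gt_eqF//; lra.
  by rewrite divr_ge0 ?sqr_ge0// !mulr_ge0//; lra.
(* What remains uses [u + v <= 2 * v] and [ln s ^+ 2 <= 4 * (a / b)]. *)
rewrite lerD2l.
have -> : 2 / lam * (v * (a / b)) = (2 * v) * (4 * (a / b)) / (4 * lam).
  by field; rewrite !gt_eqF//; lra.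
apply: ler_wpM2r; first by rewrite invr_ge0; lra.
apply: ler_pM; rewrite ?sqr_ge0//; lra.
Qed.

(** Masses and densities are separate parameters because the masses will live on a larger box. A
    pair with [X > 0] falls under [bad_pair_le] in one of two orientations; the larger flux is
    positive, hence so are the mass and the density at its source. *)
Lemma pair_le u v a b eps C m1 m2 : 0 < eps -> 0 <= C ->
  0 <= m1 -> 0 <= m2 -> 0 <= a -> 0 <= b ->
  (0 < m1 -> 0 < a) -> (0 < m2 -> 0 < b) ->
  0 <= u -> 0 <= v -> u <= C * m1 -> v <= C * m2 ->
  let X := (u - v) * (ln (b + eps) - ln (a + eps)) in
  let Y := m2 * (a / b) + m1 * (b / a) in
  X <= C * Y /\ forall lam, 0 < lam -> X <= lam * psi u v + 2 * C / lam * Y.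
Proof.
move=> e0 C0 m10 m20 a0 b0 ma mb u0 v0 uC vC X Y.
have Y1 : 0 <= m2 * (a / b) by rewrite mulr_ge0 ?divr_ge0.
have Y2 : 0 <= m1 * (b / a) by rewrite mulr_ge0 ?divr_ge0.
have good : X <= 0 ->
    X <= C * Y /\ forall lam, 0 < lam -> X <= lam * psi u v + 2 * C / lam * Y.
  move=> X0; split=> [|lam lam0]; apply: le_trans X0 _.
    by rewrite mulr_ge0 ?addr_ge0.
  apply: addr_ge0; apply: mulr_ge0; rewrite ?psi_ge0 ?addr_ge0 ?(ltW lam0)//.
  by rewrite divr_ge0 ?mulr_ge0 ?(ltW lam0).
have mono x y : 0 <= x -> x <= y -> ln (x + eps) <= ln (y + eps).
  by move=> x0 xy; rewrite ler_ln ?posrE; lra.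
have posm (x m : R) : 0 < x -> 0 <= m -> x <= C * m -> 0 < m.
  move=> x0 m0 xC; rewrite lt_neqAle m0 andbT eq_sym; apply/eqP => mz.
  by move: xC; rewrite mz mulr0; lra.
have [uv|vu] := leP u v; have [ab|ba] := leP a b.
- by apply: good; have := mono _ _ a0 ab; rewrite /X; nra.
- move: uv; rewrite le_eqVlt => /orP[/eqP uv|uv].
    by apply: good; rewrite /X uv subrr mul0r.
  have b1 : 0 < b by apply: mb; apply: posm vC => //; lra.
  have [h1 h2] := bad_pair_le e0 u0 uv b1 ba vC.
  have -> : X = (v - u) * (ln (a + eps) - ln (b + eps)) by rewrite /X; ring.
  split=> [|lam lam0]; first by apply: le_trans h1 _; rewrite ler_wpM2l ?lerDl.
  apply: le_trans (h2 _ lam0) _; rewrite lerD2l ler_wpM2l ?lerDl//.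
  by rewrite divr_ge0 ?mulr_ge0// ltW.
- move: ab; rewrite le_eqVlt => /orP[/eqP ab|ab].
    by apply: good; rewrite /X ab subrr mulr0.
  have a1 : 0 < a by apply: ma; apply: posm uC => //; lra.
  have [h1 h2] := bad_pair_le e0 v0 vu a1 ab uC.
  split=> [|lam lam0]; first by apply: le_trans h1 _; rewrite ler_wpM2l ?lerDr.
  apply: le_trans (h2 _ lam0) _; rewrite psiC lerD2l ler_wpM2l ?lerDr//.
  by rewrite divr_ge0 ?mulr_ge0// ltW.
- by apply: good; have := mono _ _ b0 (ltW ba); rewrite /X; nra.
Qed.

(** If [0 < e k], a [lam] with [D / lam <= e k / 2] forces every later increment to be at least
    [e k / 2 / lam], so [e] grows linearly past [B]. *)
Lemma bounded_growth_le0 (e : nat -> R) (B D : R) : 0 <= D ->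
  {homo e : m n / (m <= n)%N >-> m <= n} -> (forall n, e n <= B) ->
  (forall lam n, 0 < lam -> e n <= lam * (e n.+1 - e n) + D / lam) ->
  forall n, e n <= 0.
Proof.
move=> D0 emon eB eD k; rewrite leNgt; apply/negP => ek.
(* The [+ 1] keeps [lam] positive when [D = 0]. *)
pose lam := (2 * D + 1) / e k.
have lam0 : 0 < lam by rewrite divr_gt0//; lra.
have Dl : D / lam <= e k / 2.
  rewrite /lam invf_div mulrA ler_pdivrMr; last by lra.
  by nra.
pose s := e k / 2 / lam.
have s0 : 0 < s by apply: divr_gt0 => //; lra.
have step n : (k <= n)%N -> s <= e n.+1 - e n.
  move=> kn; have h := eD lam n lam0; have en := emon _ _ kn.
  rewrite /s ler_pdivrMr// mulrC; lra.
have lin j : j%:R * s <= e (k + j)%N.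
  elim: j => [|j IH]; first by rewrite mul0r addn0 ltW.
  by have := step _ (leq_addr j k); rewrite addnS -natr1; nra.
have := lin (Num.truncn (B / s)).+1.
have := truncnS_gt (B / s); rewrite ltr_pdivrMr// => h1 h2.
by have := eB (k + (Num.truncn (B / s)).+1)%N; lra.
Qed.

(** Provides the [eps] that [psi_le_ln] requires of densities. *)
Lemma exists_pos_lower_bound (T : finType) (h : T -> R) :
  exists2 eps, 0 < eps & forall t, 0 < h t -> eps <= h t.
Proof.
exists (\big[Order.min/1]_(t | 0 < h t) h t) => [|t ht].
  by elim/big_ind: _ => // x y x0 y0; rewrite lt_min x0 y0.
exact: bigmin_le_cond.
Qed.

End RealInequalities.

(** * Dirichlet forms and entropy production *)

Lemma sum_flip (V : nmodType) (Lam : {fset int}) x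
    (G : {ffun Lam -> bool} -> V) :
  \sum_zeta G (flip_on zeta x) = \sum_zeta G zeta.
Proof. by symmetry; apply: reindex_inj; exact: flip_on_inj. Qed.

Section Dirichlet.
Context {R : realType} (q : R) (c : int -> config -> R) (r : nat).
Context (mu : probability config R).
Context (q_gt0 : 0 < q) (q_lt1 : q < 1) (c_rates : kcm_rates r c).

Local Notation flux := (flip_flux mu q c).

Lemma weight_gt0 b : 0 < weight q b.
Proof. by rewrite /weight; case: b; rewrite ?subr_gt0. Qed.

Lemma weight_le1 b : weight q b <= 1.
Proof. by rewrite /weight; case: b; rewrite ?gerBl ltW. Qed.

Lemma rate_flip_on (Lam : {fset int}) x (zeta : {ffun Lam -> bool}) :
  c x (extend (flip_on zeta x)) = c x (extend zeta).
Proof.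
apply: (rate_range c_rates) => y /andP[yx _].
rewrite extend_flip_on_neq//; apply: contraTneq yx => ->.
by rewrite subrr normr0.
Qed.

Lemma flux_ge0 (Lam : {fset int}) x (zeta : {ffun Lam -> bool}) :
  0 <= flux x zeta.
Proof.
by rewrite !mulr_ge0 ?mass_ge0 ?(ltW (weight_gt0 _)) ?(rate_ge0 c_rates).
Qed.

(** As the window lies in [Lam], rate and weight are already functions on [Lam], and only the mass
    is summed out. *)
Lemma flux_marginal (Lam Lam' : {fset int}) x (G : {ffun Lam -> bool} -> R) :
  (Lam `<=` Lam')%fset -> window_sub r x Lam ->
  \sum_(zeta' : {ffun Lam' -> bool})
     flux x zeta' * G (restr Lam (extend zeta')) =
  \sum_zeta flux x zeta * G zeta.
Proof.
move=> s hw.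
pose K (zeta : {ffun Lam -> bool}) :=
  c x (extend zeta) * weight q (~~ extend zeta x) * G zeta.
transitivity (\sum_(zeta' : {ffun Lam' -> bool})
    K (restr Lam (extend zeta')) * mass mu zeta').
  apply: eq_bigr => z _; rewrite /K /flip_flux extend_restr; last first.
    by apply: hw; rewrite subrr normr0.
  rewrite (_ : c x (extend (restr _ _)) = c x (extend z)); first by ring.
  apply: (rate_range c_rates) => y /andP[_ yx]; rewrite extend_restr//.
  exact: hw.
rewrite mass_restr//; apply: eq_bigr => z _; rewrite /K /flip_flux; ring.
Qed.

(** For [x] in [Lam], each pair of opposite flips is counted twice, once from either end. *)
Definition dirichlet (Lam : {fset int}) (x : int) : R :=
  \sum_(zeta : {ffun Lam -> bool}) psi (flux x zeta) (flux x (flip_on zeta x)).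

Lemma dirichlet_ge0 (Lam : {fset int}) x : 0 <= dirichlet Lam x.
Proof. by apply: sumr_ge0 => z _; rewrite psi_ge0 ?flux_ge0. Qed.

Lemma dirichlet_eq0 (Lam : {fset int}) x (zeta : {ffun Lam -> bool}) :
  dirichlet Lam x = 0 -> flux x zeta = flux x (flip_on zeta x).
Proof.
move=> d0; apply: psi_eq0; rewrite ?flux_ge0//.
have /eqP := d0; rewrite psumr_eq0 => [/allP/(_ zeta)|z _].
  by rewrite mem_index_enum => /(_ isT)/eqP.
by rewrite psi_ge0 ?flux_ge0.
Qed.

(** Fluxes on [Lam] are sums of fluxes over the extensions to [Lam'], and [psi] is subadditive. *)
Lemma dirichlet_le (Lam Lam' : {fset int}) x :
  (Lam `<=` Lam')%fset -> window_sub r x Lam ->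
  dirichlet Lam x <= dirichlet Lam' x.
Proof.
move=> s hw.
have F zeta : flux x zeta = \sum_(zeta' : {ffun Lam' -> bool} |
    restr Lam (extend zeta') == zeta) flux x zeta'.
  have := flux_marginal (fun z => (z == zeta)%:R) s hw.
  rewrite [RHS](bigD1 zeta)//= eqxx mulr1 [X in _ + X]big1 ?addr0 => [<-|z].
    by rewrite [RHS]big_mkcond; apply: eq_bigr => z _;
      case: eqP; rewrite ?mulr1 ?mulr0.
  by move=> /negbTE->; rewrite mulr0.
(* Flipping at [x] maps the fibre over [zeta] onto the fibre over [flip_on zeta x]. *)
have Ff zeta : flux x (flip_on zeta x) = \sum_(zeta' : {ffun Lam' -> bool} |
    restr Lam (extend zeta') == zeta) flux x (flip_on zeta' x).
  rewrite F [LHS](reindex_inj (@flip_on_inj _ x))/=.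
  by apply: eq_bigl => z; rewrite restr_flip_on// (inj_eq (@flip_on_inj _ x)).
rewrite [leRHS](partition_big (fun z => restr Lam (extend z)) xpredT)//=.
apply: ler_sum => zeta _; rewrite F Ff; apply: psi_sum => z; exact: flux_ge0.
Qed.

(** The probability of [cylinder zeta] under the product measure. *)
Definition gibbs_weight (Lam : {fset int}) (zeta : {ffun Lam -> bool}) : R :=
  \prod_(y : Lam) weight q (zeta y).

Lemma gibbs_weight_gt0 (Lam : {fset int}) (zeta : {ffun Lam -> bool}) :
  0 < gibbs_weight zeta.
Proof. by apply: prodr_gt0 => y _; exact: weight_gt0. Qed.

(** Reversibility of the product measure: only the factor at [x] changes. *)
Lemma gibbs_weight_flip (Lam : {fset int}) (zeta : {ffun Lam -> bool}) x :
  x \in Lam -> weight q (extend zeta x) * gibbs_weight (flip_on zeta x) =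
               weight q (~~ extend zeta x) * gibbs_weight zeta.
Proof.
move=> xL; rewrite /gibbs_weight (bigD1 [` xL]%fset)//=.
rewrite [in RHS](bigD1 [` xL]%fset)//= ffunE/= eqxx.
rewrite -[x in extend _ x]/(val [` xL]%fset) extend_in.
rewrite [X in _ * (_ * X)](eq_bigr (fun y => weight q (zeta y))); first by ring.
by move=> y yx; rewrite ffunE ifN.
Qed.

Definition density (Lam : {fset int}) (zeta : {ffun Lam -> bool}) : R :=
  mass mu zeta / gibbs_weight zeta.

Lemma density_ge0 (Lam : {fset int}) (zeta : {ffun Lam -> bool}) :
  0 <= density zeta.
Proof. by rewrite divr_ge0 ?mass_ge0// ltW// gibbs_weight_gt0. Qed.

Lemma massEdensity (Lam : {fset int}) (zeta : {ffun Lam -> bool}) :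
  mass mu zeta = gibbs_weight zeta * density zeta.
Proof. by rewrite mulrC divfK// gt_eqF// gibbs_weight_gt0. Qed.

(** The derivative of the relative entropy up to a constant, regularized by [eps] since the density
    may vanish. *)
Definition entropy_test (eps : R) (Lam : {fset int})
    (zeta : {ffun Lam -> bool}) : R := ln (density zeta + eps).

Definition production (eps : R) (Lam Lam' : {fset int}) (x : int) : R :=
  \sum_(zeta' : {ffun Lam' -> bool}) flux x zeta' *
     (entropy_test eps (flip_on (restr Lam (extend zeta')) x) -
      entropy_test eps (restr Lam (extend zeta'))).

Lemma sum_flip_antisym (Lam : {fset int}) x (g f : {ffun Lam -> bool} -> R) :
  \sum_zeta g zeta * (f (flip_on zeta x) - f zeta) =
  2^-1 * \sum_zeta (g zeta - g (flip_on zeta x)) *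
                    (f (flip_on zeta x) - f zeta).
Proof.
pose A zeta := g zeta * (f (flip_on zeta x) - f zeta).
have -> : \sum_zeta (g zeta - g (flip_on zeta x)) *
    (f (flip_on zeta x) - f zeta) = \sum_zeta (A zeta + A (flip_on zeta x)).
  apply: eq_bigr => z _; rewrite /A.
  by rewrite flip_onK; ring.
by rewrite big_split/= (sum_flip x A); field.
Qed.

(** In [4^-1], one half comes from symmetrizing over the flip, the other from [psi_le_ln]. *)
Lemma interior_production eps (Lam Lam' : {fset int}) x :
  0 < eps -> (forall zeta : {ffun Lam -> bool},
    0 < density zeta -> eps <= density zeta) ->
  (Lam `<=` Lam')%fset -> window_sub r x Lam ->
  production eps Lam Lam' x <= - (4^-1 * dirichlet Lam x).
Proof.
move=> e0 eh s hw.
have xL : x \in Lam by apply: hw; rewrite subrr normr0.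
rewrite /production (@flux_marginal Lam Lam' x
  (fun z => entropy_test eps (flip_on z x) - entropy_test eps z) s hw).
rewrite sum_flip_antisym; set T := \sum_zeta _.
suff : dirichlet Lam x <= - (2 * T) by move: (dirichlet Lam x) T => D T; lra.
rewrite mulr_sumr -sumrN; apply: ler_sum => z _.
(* By reversibility, and as the rate ignores the value at [x], both opposite fluxes are this same
   [k] times a density. *)
pose k := c x (extend z) * weight q (~~ extend z x) * gibbs_weight z.
have Fz : flux x z = k * density z by rewrite /flip_flux massEdensity /k; ring.
have Ff : flux x (flip_on z x) = k * density (flip_on z x).
  rewrite /flip_flux massEdensity extend_flip_on_eq// negbK rate_flip_on.
  transitivity (c x (extend z) * (weight q (extend z x) *
      gibbs_weight (flip_on z x)) * density (flip_on z x)); first by ring.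
  by rewrite gibbs_weight_flip// /k; ring.
rewrite Fz Ff (le_trans (psi_le_ln e0 _ _ _ (eh z) (eh (flip_on z x))))//.
- rewrite !mulr_ge0 ?(rate_ge0 c_rates)// ltW//.
    exact: weight_gt0.
  exact: gibbs_weight_gt0.
- exact: density_ge0.
- exact: density_ge0.
- by rewrite le_eqVlt /entropy_test; apply/orP; left; apply/eqP; ring.
Qed.

(** The window of [x] may leave [Lam], so the fluxes need not be proportional to densities on [Lam];
    [pair_le] only asks that masses on [Lam'] bound them. The constants depend neither on the boxes
    nor on [eps]. *)
Lemma boundary_production C eps (Lam Lam' : {fset int}) x :
  0 <= C -> (forall y eta, c y eta <= C) -> 0 < eps ->
  (Lam `<=` Lam')%fset -> x \in Lam ->
  let K := (q * (1 - q))^-1 in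
  production eps Lam Lam' x <= C * K /\
  forall lam, 0 < lam ->
    production eps Lam Lam' x <= lam * dirichlet Lam' x + 2 * C * K / lam.
Proof.
move=> C0 cC e0 s xL K.
pose h (z : {ffun Lam' -> bool}) := density (restr Lam (extend z)).
pose Y z := mass mu (flip_on z x) * (h z / h (flip_on z x)) +
            mass mu z * (h (flip_on z x) / h z).
(* After marginalizing to [Lam], the density quotient times the mass is a ratio of Gibbs weights, at
   most [K], times the mass of the flipped configuration. *)
have YK : \sum_z Y z <= 2 * K.
  have -> : \sum_z Y z = 2 * \sum_(z : {ffun Lam' -> bool})
      (density (flip_on (restr Lam (extend z)) x) /
       density (restr Lam (extend z))) * mass mu z.
    rewrite big_split/= -[X in X + _](sum_flip x)/= mulr_natl mulr2n.
    by congr (_ + _); apply: eq_bigr => z _;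
      rewrite /h ?flip_onK restr_flip_on// mulrC.
  rewrite ler_wpM2l//.
  rewrite (mass_restr mu (fun z => density (flip_on z x) / density z) s).
  rewrite -[K]mulr1 -(mass_sum1 mu Lam) mulr_sumr -[leRHS](sum_flip x).
  apply: ler_sum => z _.
  have w0 := gibbs_weight_gt0 z; have w0' := gibbs_weight_gt0 (flip_on z x).
  have wK : gibbs_weight z <= K * gibbs_weight (flip_on z x).
    have := gibbs_weight_flip z xL.
    have [a0 b0] := (weight_gt0 (extend z x), weight_gt0 (~~ extend z x)).
    have ab : weight q (extend z x) * weight q (~~ extend z x) = q * (1 - q).
      by case: (extend z x); rewrite /weight /=; ring.
    have qq : 0 < q * (1 - q) by rewrite mulr_gt0// subr_gt0.
    move=> E; rewrite /K ler_pdivlMl// -ab -mulrA -E mulrA.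
    by rewrite ler_piMl ?(ltW w0')// mulr_ile1 ?weight_le1// ltW.
  have [m0|m0] := eqVneq (mass mu z) 0.
    rewrite m0 mulr0 mulr_ge0 ?mass_ge0//.
    by rewrite /K invr_ge0 mulr_ge0 ?subr_ge0 ?ltW.
  have -> : density (flip_on z x) / density z * mass mu z =
     gibbs_weight z / gibbs_weight (flip_on z x) * mass mu (flip_on z x).
    by rewrite /density; field; rewrite m0 !gt_eqF.
  by rewrite ler_wpM2r ?mass_ge0// ler_pdivrMr.
have mC (z : {ffun Lam' -> bool}) : flux x z <= C * mass mu z.
  rewrite ler_wpM2r ?mass_ge0//; apply: le_trans (cC x (extend z)).
  by rewrite ler_piMr ?weight_le1// (rate_ge0 c_rates).
(* [cylinder z] lies in the cylinder of its restriction to [Lam], whose mass is then positive. *)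
have hpos z : 0 < mass mu z -> 0 < h z.
  move=> m0; rewrite divr_gt0 ?gibbs_weight_gt0//.
  apply: lt_le_trans m0 _.
  have := mass_restr mu (fun z' => (z' == restr Lam (extend z))%:R) s.
  rewrite [RHS](bigD1 (restr Lam (extend z)))//= eqxx mul1r.
  rewrite [X in _ = _ + X]big1 ?addr0 => [<-|z' /negbTE->];
    last by rewrite mul0r.
  rewrite (bigD1 z)//= eqxx mul1r lerDl sumr_ge0// => z' _.
  by rewrite mulr_ge0 ?mass_ge0.
have E : production eps Lam Lam' x = 2^-1 * \sum_z
    (flux x z - flux x (flip_on z x)) *
    (ln (h (flip_on z x) + eps) - ln (h z + eps)).
  rewrite -(sum_flip_antisym x _ (fun z => ln (h z + eps))).
  by apply: eq_bigr => z _; rewrite /entropy_test /h restr_flip_on.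
have P z := pair_le e0 C0 (mass_ge0 mu z) (mass_ge0 mu (flip_on z x))
  (density_ge0 _) (density_ge0 _) (hpos z) (hpos (flip_on z x))
  (flux_ge0 x z) (flux_ge0 x (flip_on z x)) (mC z) (mC (flip_on z x)).
split=> [|lam lam0].
  rewrite E; apply: (@le_trans _ _ (2^-1 * \sum_z C * Y z)).
    by rewrite ler_wpM2l ?invr_ge0//; apply: ler_sum => z _; exact: (P z).1.
  by rewrite -mulr_sumr; nra.
rewrite E; apply: (@le_trans _ _ (2^-1 * \sum_z
   (lam * psi (flux x z) (flux x (flip_on z x)) + 2 * C / lam * Y z))).
  by rewrite ler_wpM2l ?invr_ge0//; apply: ler_sum => z _; exact: (P z).2.
rewrite big_split/= -!mulr_sumr -/(dirichlet Lam' x).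
have d0 := dirichlet_ge0 Lam' x.
have : 2 * C / lam * \sum_z Y z <= 2 * C / lam * (2 * K).
  by rewrite ler_wpM2l// divr_ge0 ?mulr_ge0// ltW.
(* Symmetrization leaves [lam / 2] in front of the Dirichlet form; this sign allows [lam]. *)
have : 0 <= lam * dirichlet Lam' x by rewrite mulr_ge0// ltW.
have -> : 2 * C * K / lam = 2^-1 * (2 * C / lam * (2 * K)).
  by field; rewrite gt_eqF.
set D := lam * _; set A := 2 * C / lam * \sum_z _; lra.
Qed.

End Dirichlet.

(** * Growing boxes *)

Definition box (n : nat) : {fset int} :=
  [fset i in [seq Posz i - Posz n | i <- iota 0 (2 * n).+1]]%fset.

Lemma in_box n (x : int) : (x \in box n) = (`|x| <= n%:Z).
Proof.
rewrite in_fset; apply/mapP/idP => [[i]|xn].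
  by rewrite mem_iota => /andP[_ i_lt] ->; lia.
by exists (absz (x + n%:Z)); rewrite ?mem_iota; lia.
Qed.

Lemma card_box n : #|` box n| = (2 * n).+1.
Proof.
rewrite card_fseq undup_id ?size_map ?size_iota// map_inj_uniq ?iota_uniq//.
by move=> i j /addIr [].
Qed.

Lemma box_sub m n : (m <= n)%N -> (box m `<=` box n)%fset.
Proof. by move=> mn; apply/fsubsetP => x; rewrite !in_box; lia. Qed.

Lemma fset_sub_box (Lam : {fset int}) : exists n, (Lam `<=` box n)%fset.
Proof.
exists (\max_(y : Lam) `|val y|%N); apply/fsubsetP => y yL; rewrite in_box.
have := @leq_bigmax _ (fun y : Lam => `|val y|%N) [` yL]%fset => /=; lia.
Qed.

Lemma sum_fset_sub (V : nmodType) (A B : {fset int}) (F : int -> V) :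
  (A `<=` B)%fset ->
  \sum_(x <- B) F x = \sum_(x <- A) F x + \sum_(x <- (B `\` A)%fset) F x.
Proof.
move=> /fsubsetP AB; rewrite (big_fsetID _ (mem A))/=; congr (_ + _).
  by apply: eq_fbigl => x; rewrite !inE/=; apply: andb_idl => /AB.
by apply: eq_fbigl => x; rewrite !inE/= andbC.
Qed.

Section BoundaryGrowth.
Context {R : realType} (q : R) (c : int -> config -> R) (r : nat).
Context (S : R -> (config -> R) -> config -> R) (mu : probability config R).
Context (q_gt0 : 0 < q) (q_lt1 : q < 1) (c_rates : kcm_rates r c).
Context (S_kcm : kcm_semigroup q c S) (mu_stat : stationary S mu).

(** Margins of width [r] would contain the windows; [r.+1] makes the boxes exhaust the integers even
    if [r = 0]. *)
Let L k := box (k * r.+1).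

Let L_sub k : (L k `<=` L k.+1)%fset.
Proof. by apply: box_sub; rewrite leq_mul2r leqnSn orbT. Qed.

Let L_window k x : x \in L k -> window_sub r x (L k.+1).
Proof. by rewrite in_box => xk y yx; rewrite in_box mulSn; lia. Qed.

Let split_L k (F : int -> R) :
  \sum_(x <- L k.+1) F x =
  \sum_(x <- L k) F x + \sum_(x <- (L k.+1 `\` L k)%fset) F x.
Proof.
exact: sum_fset_sub (L_sub k).
Qed.

(** Dimension one enters here: the number of margin sites does not depend on [k]. *)
Let boundary_sum k (a : R) :
  \sum_(x <- (L k.+1 `\` L k)%fset) a = (2 * r.+1)%:R * a.
Proof.
rewrite big_seq_fsetE/= sumr_const -cardfE cardfsDS ?L_sub// !card_box.
by rewrite mulr_natl; congr (_ *+ _); lia.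
Qed.

Let e k := \sum_(x <- L k) dirichlet q c mu (L k.+1) x.

(** Sites of [L k] gain by monotonicity of the Dirichlet form in the box; margin sites give the same
    terms on both sides. *)
Let growth k : e k + \sum_(x <- (L k.+1 `\` L k)%fset)
  dirichlet q c mu (L k.+2) x <= e k.+1.
Proof.
rewrite {2}/e split_L lerD2r /e big_seq [leRHS]big_seq; apply: ler_sum => x xk.
apply: (dirichlet_le mu q_gt0 q_lt1 c_rates (L_sub k.+1)); exact: L_window.
Qed.

(** With the test function on [L k.+1] and fluxes on [L k.+2], the total production vanishes, so the
    margin pays for the dissipation in [L k]; [growth] bounds the Dirichlet forms of the margin by
    the increment of [e]. *)
Let entropy_balance C k : 0 <= C -> (forall y eta, c y eta <= C) ->
  let K := (q * (1 - q))^-1 in let N := (2 * r.+1)%:R in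
  4^-1 * e k <= N * (C * K) /\
  forall lam, 0 < lam ->
    4^-1 * e k <= lam * (e k.+1 - e k) + N * (2 * C * K / lam).
Proof.
move=> C0 cC K N.
(* This [eps] varies with [k], but the bounds do not contain it. *)
have [eps e0 eh] := exists_pos_lower_bound (@density R q mu (L k.+1)).
pose A := production q c mu eps (L k.+1) (L k.+2).
have A0 : \sum_(x <- L k.+1) A x = 0.
  exact: (stationary_flux mu_stat c_rates S_kcm.2
    (@entropy_test R q mu eps (L k.+1)) (L_sub k.+1) (@L_window k.+1)).
have Ae : \sum_(x <- L k) A x <= - (4^-1 * e k).
  rewrite /e mulr_sumr -sumrN big_seq [leRHS]big_seq; apply: ler_sum => x xk.
  apply: (interior_production q_gt0 q_lt1 c_rates e0 eh (L_sub _)).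
  exact: L_window.
have eA : 4^-1 * e k <= \sum_(x <- (L k.+1 `\` L k)%fset) A x.
  by move: A0; rewrite split_L; set T := \sum_(x <- (_ `\` _)%fset) _; lra.
have P x : x \in (L k.+1 `\` L k)%fset -> _ := fun xB =>
  boundary_production mu q_gt0 q_lt1 c_rates C0 cC e0 (L_sub k.+1)
    (fsubsetP (fsubsetDl _ _) x xB).
split=> [|lam lam0]; apply: le_trans eA _.
  rewrite -(boundary_sum k) big_seq [leRHS]big_seq; apply: ler_sum => x xB.
  exact: (P x xB).1.
apply: (@le_trans _ _ (\sum_(x <- (L k.+1 `\` L k)%fset)
    (lam * dirichlet q c mu (L k.+2) x + 2 * C * K / lam))).
  rewrite big_seq [leRHS]big_seq; apply: ler_sum => x xB.
  exact: (P x xB).2.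
rewrite big_split/= boundary_sum lerD2r -mulr_sumr ler_pM2l//.
by rewrite lerBrDl growth.
Qed.

Lemma stationary_dirichlet0 (Lam : {fset int}) x :
  window_sub r x Lam -> dirichlet q c mu Lam x = 0.
Proof.
move=> hw.
have [C cC] := rate_bounded c_rates.
have C0 : 0 <= C.
  by apply: le_trans (cC 0 (fun=> false)); exact: (rate_ge0 c_rates).
pose K := (q * (1 - q))^-1; pose N : R := (2 * r.+1)%:R.
have K0 : 0 <= K by rewrite invr_ge0 mulr_ge0 ?subr_ge0 ?ltW.
have NCK : 0 <= N * (C * K) by rewrite !mulr_ge0.
have e_le0 : forall k, e k <= 0.
  (* The 4 clears [4^-1]; [32 = 4 * 2 * 4] because [entropy_balance] is used at [lam / 4]. *)
  apply: (@bounded_growth_le0 R e (4 * (N * (C * K))) (32 * (N * (C * K)))).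
  - by rewrite mulr_ge0.
  - apply: homo_leq => [//|k1 k2 k3|k]; first exact: le_trans.
    apply: le_trans (growth k); rewrite lerDl sumr_ge0// => y _.
    exact: (dirichlet_ge0 mu q_gt0 q_lt1 c_rates).
  - by move=> k; have [+ _] := entropy_balance k C0 cC; rewrite -/K -/N; lra.
  - move=> lam k lam0; have [_] := entropy_balance k C0 cC.
    have lam4 : 0 < lam / 4 by lra.
    move=> /(_ _ lam4); rewrite -/K -/N.
    have -> : N * (2 * C * K / (lam / 4)) = 4^-1 * (32 * (N * (C * K)) / lam).
      by field; rewrite gt_eqF.
    set T := _ / lam; have -> : lam / 4 * (e k.+1 - e k) =
      4^-1 * (lam * (e k.+1 - e k)) by field.
    by set U := lam * _; lra.
have [n Ln] := fset_sub_box Lam.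
have LL : (Lam `<=` L n)%fset.
  by apply: fsubset_trans Ln _; apply: box_sub; rewrite leq_pmulr.
have xL : x \in L n by apply: (fsubsetP LL); apply: hw; rewrite subrr normr0.
apply/eqP; rewrite eq_le (dirichlet_ge0 mu q_gt0 q_lt1 c_rates) andbT.
(* The term of [x] in [e n] dominates the form on [Lam], and the other terms are nonnegative. *)
apply: le_trans (e_le0 n); rewrite /e (big_fsetD1 x)//=.
apply: (@le_trans _ _ (dirichlet q c mu (L n.+1) x)).
  apply: (dirichlet_le mu q_gt0 q_lt1 c_rates) => //.
  exact: fsubset_trans LL (L_sub n).
rewrite lerDl sumr_ge0// => y _.
exact: (dirichlet_ge0 mu q_gt0 q_lt1 c_rates).
Qed.

End BoundaryGrowth.

(** * From equal opposite fluxes to detailed balance *)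

Theorem theorem2p5 (R : realType) (q : R) (q_gt0 : 0 < q) (q_lt1 : q < 1)
    (r : nat) (c : int -> config -> R) (c_rates : kcm_rates r c)
    (S : R -> (config -> R) -> (config -> R)) (S_kcm : kcm_semigroup q c S)
    (pi : probability config R) (pi_prod : product_measure q pi)
    (mu : probability config R) (mu_stat : stationary S mu)
    (Lam : {fset int}) (x : int) (x_window : window_sub r x Lam)
    (zeta : {ffun Lam -> bool}) :
  ((rate_on c x zeta)%:E * pi (cylinder (flip_on zeta x)) * mu (cylinder zeta) =
   (rate_on c x zeta)%:E * pi (cylinder zeta) * mu (cylinder (flip_on zeta x)))%E.
Proof.
have xL : x \in Lam by apply: x_window; rewrite subrr normr0.
have d0 := stationary_dirichlet0 q_gt0 q_lt1 c_rates S_kcm mu_stat x_window.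
have := dirichlet_eq0 q_gt0 q_lt1 c_rates zeta d0.
rewrite /flip_flux extend_flip_on_eq// negbK.
rewrite (rate_flip_on c_rates) -/(rate_on c x zeta) => fluxE.
have piE z : pi (cylinder z) = (gibbs_weight q z)%:E := pi_prod Lam z.
have muE z := massE mu z.
rewrite [X in (_ * X * _ = _)%E]piE [X in (_ = _ * X * _)%E]piE.
rewrite [X in (_ * X = _)%E]muE [X in (_ = _ * X)%E]muE -!EFinM; congr _%:E.
have w0 := weight_gt0 q_gt0 q_lt1 (extend zeta x).
(* The positive weight of the current value at [x] is inserted so that [gibbs_weight_flip] applies
   and the two fluxes appear. *)
apply: (mulfI (lt0r_neq0 w0)).
have gE := gibbs_weight_flip q zeta xL.
transitivity (rate_on c x zeta * (weight q (extend zeta x) *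
  gibbs_weight q (flip_on zeta x)) * mass mu zeta); first by ring.
rewrite gE.
transitivity (rate_on c x zeta * weight q (~~ extend zeta x) * mass mu zeta *
  gibbs_weight q zeta); first by ring.
by rewrite fluxE; ring.
Qed.
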